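(* Let $\mathcal{S}$ be a finite state space, $V:\mathcal{S}\to\mathbb{R}$ a function, $\pi$ the probability distribution on $\mathcal{S}$ with $\pi(s)\propto\exp(-V(s))$, and $T(g\mid f)$ a transition kernel on $\mathcal{S}$ satisfying $\pi(f)T(g\mid f)=\pi(g)T(f\mid g)$ for all $f,g\in\mathcal{S}$. Let $(X_t)_{t\ge 0}$ be the Markov chain on $\mathcal{S}$ with transition kernel $T$, and for $f\in\mathcal{S}$ let $$\Delta(f)=\mathbb{E}[V(X_{t+1})-V(X_t)\mid X_t=f]=\sum_{g\in\mathcal{S}}T(g\mid f)\big(V(g)-V(f)\big).$$ Let $m=\min_{s\in\mathcal{S}}V(s)$. For a threshold $b\in\mathbb{R}$, let $B=\{x\in\mathcal{S}:V(x)\le b\}$ and $\tau_B=\inf\{t\ge 0:X_t\in B\}$. Assume there exists a constant $\gamma>0$ such that $\Delta(f)\le-\gamma$ for all $f\notin B$. Then for any initial state $X_0=f$, $$\mathbb{E}_f[\tau_B]\le\frac{V(f)-m}{\gamma}.$$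
   Context: A transition kernel $T$ satisfies $T(g\mid f)\ge 0$ and $\sum_{g\in\mathcal{S}}T(g\mid f)=1$ for every $f\in\mathcal{S}$; $T(g\mid f)$ is the probability of moving from $f$ to $g$. $\mathbb{E}_f$ denotes expectation for the chain started at $X_0=f$. The infimum of the empty set is $+\infty$. *)

(* Defs.v *)
From HB Require Import structures.
From mathcomp Require Import all_boot all_order all_algebra.
From mathcomp Require Import all_classical all_reals all_analysis.
Set Implicit Arguments.
Unset Strict Implicit.
Unset Printing Implicit Defensive.
Import Order.TTheory GRing.Theory Num.Theory.
Import numFieldNormedType.Exports.
Local Open Scope classical_set_scope.
Local Open Scope ring_scope.

(* The arguments of a kernel follow the order of T(g | f): [T g f] is the
   probability of moving from [f] to [g]. *)
Definition transition_kernel (R : realType) (S : finType) (T : S -> S -> R) :=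
  (forall f g : S, 0 <= T g f) /\ (forall f : S, \sum_(g : S) T g f = 1).

Definition gibbs (R : realType) (S : finType) (V : S -> R) (s : S) : R :=
  expR (- V s) / \sum_(u : S) expR (- V u).

Definition reversible (R : realType) (S : finType) (p : S -> R)
    (T : S -> S -> R) :=
  forall f g : S, p f * T g f = p g * T f g.

Definition drift (R : realType) (S : finType) (V : S -> R) (T : S -> S -> R)
    (f : S) : R :=
  \sum_(g : S) T g f * (V g - V f).

(* The minimum of [V] over all of [S]; [s0] only witnesses that [S] is
   nonempty, and the value does not depend on it. *)
Definition min_value (R : realType) (S : finType) (V : S -> R) (s0 : S) : R :=
  V [arg min_(s < s0) V s]%O.

Definition sublevel (R : realType) (S : finType) (V : S -> R) (b : R) : set S :=
  [set x | V x <= b].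

(* [S] carries the discrete sigma-algebra, so that measurability of [X t] is
   measurability of its fibres. The Markov property
     P(X_{t+1} = g | X_0 = x_0, ..., X_t = x_t) = T(g | x_t)
   is multiplied through by the probability of the conditioning event, which
   leaves no constraint when that probability is 0. *)
Definition markov_chain_from (R : realType) (S : finType) (T : S -> S -> R)
    (f : S) (d : measure_display) (Omega : measurableType d)
    (P : probability Omega R) (X : nat -> Omega -> S) :=
  [/\ forall (t : nat) (s : S), measurable (X t @^-1` [set s]),
      P [set w | X 0%N w = f] = 1%E &
      forall (t : nat) (x : nat -> S) (g : S),
        P ([set w | forall k : nat, (k <= t)%N -> X k w = x k] `&`
           [set w | X t.+1 w = g]) =
        (P [set w | forall k : nat, (k <= t)%N -> X k w = x k] *
         (T g (x t))%:E)%E].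

Definition hitting_time (R : realType) (S : Type) (Omega : Type)
    (X : nat -> Omega -> S) (B : set S) (w : Omega) : \bar R :=
  ereal_inf [set (t%:R : R)%:E | t in [set t : nat | B (X t w)]].

(* Main.v *)
Require Import Defs.
From HB Require Import structures.
From mathcomp Require Import all_boot all_order all_algebra.
From mathcomp Require Import all_classical all_reals all_analysis.
From mathcomp Require Import measurable_realfun.
Import Order.TTheory GRing.Theory Num.Theory.
Import numFieldNormedType.Exports.
Local Open Scope classical_set_scope.
Local Open Scope ring_scope.

(* Let u_t(s) = P(tau_B >= t, X_t = s). The Markov property gives the killed
   recursion u_{t+1}(g) = sum_{s notin B} u_t(s) T(g | s), so with W = V - m
   the quantity a_t = sum_{s notin B} u_t(s) W(s) satisfies
   a_{t+1} <= a_t - gamma P(tau_B > t). Telescoping and a_t >= 0 yield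
   gamma sum_{t < n} P(tau_B > t) <= a_0 <= W(f), and E[tau_B] is the sum of
   the tails P(tau_B > t). *)

Lemma killed_mass_bound {R : realType} {S : finType} (T : S -> S -> R)
    (W : S -> R) (A : pred S) (gamma : R) (u : nat -> S -> R) :
  transition_kernel T -> (forall s, 0 <= W s) ->
  (forall s, ~~ A s -> drift W T s <= - gamma) ->
  (forall t s, 0 <= u t s) ->
  (forall t g, u t.+1 g = \sum_(s | ~~ A s) u t s * T g s) ->
  forall n, gamma * \sum_(t < n) \sum_(s | ~~ A s) u t s <=
            \sum_(s | ~~ A s) u 0%N s * W s.
Proof.
move=> [T0 T1] W0 Wd u0 uS n.
pose a t := \sum_(s | ~~ A s) u t s * W s.
(* Keeping [- a n] on the right makes the induction telescope; it is dropped afterwards since [W] is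
   nonnegative. *)
suff : gamma * \sum_(t < n) \sum_(s | ~~ A s) u t s <= a 0%N - a n.
  by move/le_trans; apply; rewrite gerBl sumr_ge0// => s _; rewrite mulr_ge0.
elim: n => [|n IHn]; first by rewrite big_ord0 mulr0 subrr.
rewrite big_ord_recr mulrDr /= -(subrK (a n) (a 0%N)) -addrA lerD//.
rewrite lerBrDr addrC -lerBrDr /a mulr_sumr -sumrB.
under eq_bigr do rewrite uS mulr_suml.
rewrite exchange_big/=; apply: ler_sum => s As.
have -> : u n s * W s - gamma * u n s = u n s * (W s - gamma).
  by rewrite mulrBr (mulrC gamma).
under eq_bigr do rewrite -mulrA.
rewrite -mulr_sumr ler_wpM2l//.
(* Restoring the killed transitions, those into [A], only enlarges the sum because [W] is
   nonnegative; what results is the full one-step expectation of [W] from [s]. *)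
apply: (@le_trans _ _ (\sum_g T g s * W g)).
  rewrite big_mkcond/=; apply: ler_sum => g _.
  by case: ifP => // _; rewrite mulr_ge0.
have -> : \sum_g T g s * W g = drift W T s + W s.
  rewrite /drift -[X in _ + X]mul1r -(T1 s) mulr_suml -big_split/=.
  by apply: eq_bigr => g _; rewrite mulrBr subrK.
by rewrite addrC lerD2l Wd.
Qed.

Lemma measure_fibres {R : realType} {S : finType} {d : measure_display}
    {Omega : measurableType d} (P : probability Omega R)
    (Y : Omega -> S) (E : set Omega) :
  (forall s, measurable (Y @^-1` [set s])) -> measurable E ->
  P E = (\sum_s P (E `&` Y @^-1` [set s]))%E.
Proof.
move=> mY mE.
have -> : (\sum_s P (E `&` Y @^-1` [set s]) =
           \sum_(s \in [set: S]) P (E `&` Y @^-1` [set s]))%E.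
  rewrite (@fsbigE _ _ _ _ _ (index_enum S))//=.
  - by apply: eq_bigl => s; rewrite in_setT.
  - exact: index_enum_uniq.
  - by move=> s _; rewrite mem_index_enum.
rewrite -(measure_fin_bigcup P finite_finset).
- congr (P _); apply/seteqP; split=> [w Ew|w [s _ []]//].
  by exists (Y w).
- by move=> s s' _ _ [w [[_ <-] [_ <-]]].
- by move=> s _; exact: measurableI.
Qed.

Lemma measurable_fibres {S : finType} {d : measure_display}
    {Omega : measurableType d} (Y : Omega -> S) (A : set S) :
  (forall s, measurable (Y @^-1` [set s])) -> measurable (Y @^-1` A).
Proof.
move=> mY; rewrite (_ : _ @^-1` _ = \bigcup_(s in A) (Y @^-1` [set s])).
  by apply: fin_bigcup_measurable => //; exact: finite_finset.
by apply/seteqP; split=> [w Aw|w [s As Yw]];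
  [exists (Y w)|rewrite /preimage/= Yw].
Qed.

(** With [A] as target this is the event tau >= t: the inequality is strict, so [X t] itself stays
    unconstrained and tau > t is [avoiding X A t.+1]. *)
Definition avoiding {S Omega : Type} (X : nat -> Omega -> S) (A : pred S)
    (t : nat) : set Omega :=
  [set w | forall k, (k < t)%N -> ~~ A (X k w)].

(** The window interpolates between the cylinders of the Markov property ([j = 0]) and a condition
    on [X t] alone ([j = t]). *)
Definition following {S Omega : Type} (X : nat -> Omega -> S) (x : nat -> S)
    (j t : nat) : set Omega :=
  [set w | forall k, (j <= k <= t)%N -> X k w = x k].

Lemma measurable_avoiding {S : finType} {d : measure_display}
    {Omega : measurableType d} (X : nat -> Omega -> S) (A : pred S) (t : nat) :
  (forall t s, measurable (X t @^-1` [set s])) -> measurable (avoiding X A t).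
Proof.
move=> mX.
rewrite (_ : avoiding _ _ _ =
    \bigcap_(k in [set k | (k < t)%N]) (X k @^-1` [set s | ~~ A s])).
  by apply: bigcap_measurableType => k _; exact: measurable_fibres.
by apply/seteqP; split=> w h k /h.
Qed.

Lemma measurable_following {S : finType} {d : measure_display}
    {Omega : measurableType d} (X : nat -> Omega -> S) (x : nat -> S)
    (j t : nat) :
  (forall t s, measurable (X t @^-1` [set s])) ->
  measurable (following X x j t).
Proof.
move=> mX.
rewrite (_ : following _ _ _ _ =
    \bigcap_(k in [set k | (j <= k <= t)%N]) (X k @^-1` [set x k])).
  by apply: bigcap_measurableType => k _; exact: mX.
by apply/seteqP; split=> w h k /h.
Qed.

(* Induction on [j]: conditioning on the value of [X j] turns an avoided
   coordinate into a prescribed one, until the event is a cylinder. *)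
Lemma markov_avoiding_following {R : realType} {S : finType} {T : S -> S -> R}
    {f : S} {d : measure_display} {Omega : measurableType d}
    {P : probability Omega R} {X : nat -> Omega -> S} (A : pred S)
    (t j : nat) (x : nat -> S) (g : S) :
  markov_chain_from T f P X -> (j <= t)%N ->
  P (avoiding X A j `&` following X x j t `&` X t.+1 @^-1` [set g]) =
  (P (avoiding X A j `&` following X x j t) * (T g (x t))%:E)%E.
Proof.
move=> [mX _ markov]; elim: j x => [|j IHj] x jt.
  rewrite (_ : avoiding X A 0 `&` _ =
      [set w | forall k, (k <= t)%N -> X k w = x k]); first exact: markov.
  by apply/seteqP; split=> w /=; [move=> [_ h] k kt; apply: h|move=> h; split].
pose upd s k := if k == j then s else x k.
(* Fixing [X j] at [s] either contradicts avoidance or extends the window down to time [j] along the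
   modified path. *)
have fibre s : avoiding X A j.+1 `&` following X x j.+1 t `&`
    X j @^-1` [set s] =
    if A s then set0 else avoiding X A j `&` following X (upd s) j t.
  apply/seteqP; split=> w.
    move=> [[h1 h2] /= Xs]; case: ifPn => As.
      by have := h1 j (ltnSn j); rewrite Xs As.
    split=> [k kj|k /andP[jk kt]]; first exact/h1/ltnW.
    by rewrite /upd; case: eqP => [->//|/eqP kj]; apply: h2;
      rewrite ltn_neqAle eq_sym kj jk.
  case: ifPn => // As [h1 h2].
  have Xs : X j w = s by rewrite h2 ?leqnn ?(ltnW jt)// /upd eqxx.
  split=> //; split=> k.
    by rewrite ltnS leq_eqVlt => /predU1P[->|/h1//]; rewrite Xs.
  move=> /andP[jk kt]; rewrite h2 ?(ltnW jk)// /upd.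
  by case: eqP jk => // ->; rewrite ltnn.
have mE : measurable (avoiding X A j.+1 `&` following X x j.+1 t).
  by apply: measurableI;
    [exact: measurable_avoiding|exact: measurable_following].
rewrite (measure_fibres P (X j))//; last exact: measurableI.
rewrite [in RHS](measure_fibres P (X j))//.
rewrite ge0_sume_distrl//.
apply: eq_bigr => s _; rewrite setIAC fibre; case: ifPn => As.
  by rewrite set0I measure0 mul0e.
(* As [j < t], the modified path still ends at [x t], so every fibre carries the same factor
   [T g (x t)]. *)
by rewrite IHj ?(ltnW jt)// /upd; case: eqP jt => // ->; rewrite ltnn.
Qed.

(** This is the killed recursion: split over the value of [X t], then use the Markov property with a
    window reduced to time [t]. *)
Lemma markov_avoiding {R : realType} {S : finType} {T : S -> S -> R}
    {f : S} {d : measure_display} {Omega : measurableType d}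
    {P : probability Omega R} {X : nat -> Omega -> S} (A : pred S)
    (t : nat) (g : S) :
  markov_chain_from T f P X ->
  P (avoiding X A t.+1 `&` X t.+1 @^-1` [set g]) =
  (\sum_(s | ~~ A s) P (avoiding X A t `&` X t @^-1` [set s]) *
     (T g s)%:E)%E.
Proof.
move=> hX; have [mX _ _] := hX.
rewrite (measure_fibres P (X t))//; last first.
  by apply: measurableI => //; exact: measurable_avoiding.
rewrite [RHS]big_mkcond/=; apply: eq_bigr => s _.
have fol : following X (fun=> s) t t = X t @^-1` [set s].
  apply/seteqP; split=> w /=; first by apply; rewrite leqnn.
  by move=> Xs k; rewrite -eqn_leq => /eqP <-.
rewrite -fol; case: ifPn => As; last first.
  rewrite (_ : _ `&` _ = set0) ?measure0//.
  rewrite fol -subset0 => w [[h _] /= Xs].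
  by have := h t (ltnSn t); rewrite Xs (negPn As).
rewrite -(markov_avoiding_following A t t (fun=> s) g hX (leqnn t)).
(* Once [X t = s] lies outside [A], avoiding [A] before [t] and before [t.+1] amount to the same. *)
rewrite setIAC; congr (P (_ `&` _)); rewrite fol.
apply/seteqP; split=> w [h /= Xs]; split=> // k; first by move/ltnW; exact: h.
by rewrite ltnS leq_eqVlt => /predU1P[->|/h//]; rewrite Xs.
Qed.

(** The n-th indicator is that of tau > n, so the series counts the times before the first visit.
    This holds pointwise, infinite values included. *)
Lemma hitting_time_tail_sum {R : realType} {S Omega : Type}
    (X : nat -> Omega -> S) (A : pred S) (w : Omega) :
  hitting_time R X [set s | A s] w =
  (\sum_(0 <= n <oo) (\1_(avoiding X A n.+1) w)%:E)%E.
Proof.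
have tail_ge0 n : (0 <= (\1_(avoiding X A n.+1) w)%:E :> \bar R)%E.
  by rewrite lee_fin.
have tail_sum N : avoiding X A N w ->
    (\sum_(0 <= n < N) (\1_(avoiding X A n.+1) w)%:E = (N%:R)%:E :> \bar R)%E.
  move=> avN; rewrite big_nat (eq_bigr (fun=> 1%E)).
    by rewrite -big_nat sumEFin big_const_nat iter_addr_0 subn0.
  move=> n /andP[_ nN]; rewrite indicE mem_set// => k kn.
  by apply: avN; exact: leq_trans kn nN.
have [[t At]|noA] := pselect (exists t, A (X t w)).
  have exA : exists t, A (X t w) by exists t.
  case: (ex_minnP exA) => N AN minN.
  have avN : avoiding X A N w.
    by move=> k kN; apply: contraTN kN => /minN; rewrite -leqNgt.
  (* At the first visit [N] the series splits into [N] ones followed by zeros. *)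
  rewrite (nneseries_split 0 N)// add0n tail_sum// eseries0 ?adde0.
    apply/eqP; rewrite eq_le; apply/andP; split.
      by apply: ereal_inf_lbound; exists N.
    by apply: le_ereal_inf_tmp => _ [k /= Ak <-]; rewrite lee_fin ler_nat minN.
  move=> n Nn _; rewrite indicE memNset// => /(_ N).
  by rewrite ltnS AN => /(_ Nn).
(* Without a visit, the infimum is over the empty set and the partial sums exceed every real [r]. *)
rewrite /hitting_time (_ : [set t | _ ] = set0) ?image_set0 ?ereal_inf0.
  apply/esym/eq_infty => r.
  apply: (@le_trans _ _ ((Num.bound `|r|)%:R)%:E).
    by rewrite lee_fin ltW// (le_lt_trans (ler_norm r))// archi_boundP.
  rewrite -tail_sum; first exact: nneseries_lim_ge.
  by move=> k _; apply/negP => Ak; apply: noA; exists k.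
by rewrite -subset0 => t /= At; apply: noA; exists t.
Qed.

Lemma expected_hitting_time {R : realType} {S : finType}
    {d : measure_display} {Omega : measurableType d}
    (P : probability Omega R) (X : nat -> Omega -> S) (A : pred S) :
  (forall t s, measurable (X t @^-1` [set s])) ->
  (\int[P]_w hitting_time R X [set s | A s] w =
   \sum_(0 <= n <oo) P (avoiding X A n.+1))%E.
Proof.
move=> mX; have mA n := measurable_avoiding X A n mX.
under eq_integral do rewrite hitting_time_tail_sum.
rewrite integral_nneseries//=.
- by apply: eq_eseriesr => n _; rewrite integral_indic// setIT.
- by move=> n; apply/measurable_EFinP; exact: measurable_indic.
Qed.

Theorem theorem4p7 (R : realType) (S : finType) (V : S -> R) (T : S -> S -> R)
  (hT : transition_kernel T)
  (hrev : reversible (gibbs V) T)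
  (b gamma : R) (hgamma : 0 < gamma)
  (hdrift : forall f : S, ~ sublevel V b f -> drift V T f <= - gamma)
  (f : S)
  (d : measure_display) (Omega : measurableType d) (P : probability Omega R)
  (X : nat -> Omega -> S)
  (hX : markov_chain_from T f P X) :
  (\int[P]_w hitting_time R X (sublevel V b) w <=
   ((V f - min_value V f) / gamma)%:E)%E.
Proof.
have [mX X0 _] := hX.
pose A : pred S := fun s => V s <= b.
pose W s := V s - min_value V f.
have W0 s : 0 <= W s.
  by rewrite subr_ge0 /min_value; case: arg_minP => // s0 _; exact.
have Wd s : ~~ A s -> drift W T s <= - gamma.
  move=> /negP As; apply: le_trans (hdrift s As).
  (* The drift is unchanged when a constant is subtracted from the potential. *)
  rewrite le_eqVlt; apply/orP; left.
  by apply/eqP/eq_bigr => g _; rewrite /W opprB addrA subrK.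
pose u t s := fine (P (avoiding X A t `&` X t @^-1` [set s])).
have mE t s : measurable (avoiding X A t `&` X t @^-1` [set s]).
  by apply: measurableI => //; exact: measurable_avoiding.
have uE t s : (u t s)%:E = P (avoiding X A t `&` X t @^-1` [set s]).
  by rewrite fineK// fin_num_measure.
have u0 t s : 0 <= u t s by rewrite fine_ge0.
have uS t g : u t.+1 g = \sum_(s | ~~ A s) u t s * T g s.
  apply: EFin_inj; rewrite uE (markov_avoiding A t g hX) -sumEFin.
  by apply: eq_bigr => s _; rewrite EFinM uE.
have tailE t : P (avoiding X A t.+1) = (\sum_(s | ~~ A s) u t s)%:E.
  rewrite (measure_fibres P (X t))//; last exact: measurable_avoiding.
  rewrite -sumEFin [RHS]big_mkcond/=; apply: eq_bigr => s _.
  case: ifPn => As; last first.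
    rewrite (_ : _ `&` _ = set0) ?measure0// -subset0 => w [h /= Xs].
    by have := h t (ltnSn t); rewrite Xs (negPn As).
  rewrite uE; congr (P _); apply/seteqP.
  split=> w [h /= Xs]; split=> // k; first by move/ltnW; exact: h.
  by rewrite ltnS leq_eqVlt => /predU1P[->|/h//]; rewrite Xs.
(* The initial mass sits at [f]; only an inequality holds in general, since the left side is 0 when
   [f] is already in [A]. *)
have init : \sum_(s | ~~ A s) u 0%N s * W s <= W f.
  have u00 s : s != f -> u 0%N s = 0.
    move=> sf; apply/EFin_inj; rewrite uE; apply/eqP.
    rewrite eq_le measure_ge0 andbT.
    have mf : measurable [set w | X 0%N w = f] by exact: mX.
    have PC : P (~` [set w | X 0%N w = f]) = 0%E.
      by rewrite probability_setC// X0 subee.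
    apply: (@le_trans _ _ (P (~` [set w | X 0%N w = f]))); last by rewrite PC.
    apply: le_measure; rewrite ?inE//; first exact: measurableC.
    by move=> w [_ /= ->]; exact/eqP.
  have u1 : u 0%N f <= 1.
    by rewrite -lee_fin uE; exact: probability_le1.
  apply: (@le_trans _ _ (\sum_s u 0%N s * W s)).
    rewrite big_mkcond; apply: ler_sum => s _.
    by case: ifP => // _; rewrite mulr_ge0.
  rewrite (bigD1 f)//= big1 ?addr0; first by rewrite ler_piMl.
  by move=> s sf; rewrite u00// mul0r.
rewrite (expected_hitting_time P X A mX).
(* The bound on partial sums is uniform in [n], so it passes to the limit and also yields finiteness
   of the expectation. *)
apply: lime_le; first exact: is_cvg_nneseries.
apply: nearW => n /=; rewrite big_mkord.
under eq_bigr do rewrite tailE.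
rewrite sumEFin lee_fin ler_pdivlMr// mulrC.
exact: le_trans (killed_mass_bound T W A gamma u hT W0 Wd u0 uS n) init.
Qed.
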